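(* Let $d\ge2$, let $q$ be a prime power, and let $K\subseteq\mathbb{F}_q^d$ be a Kakeya set. Then there exists a probability measure $\mu$ on $K$ satisfying $|\widehat\mu(\xi)|\le q^{-1}$ for all non-zero $\xi\in\mathbb{F}_q^d$. In particular $|K|\gtrsim q^2$. Moreover, for all $d\ge2$, $\kappa\in(0,1)$ and sufficiently large $q$, there exists a Kakeya set $K'\subseteq\mathbb{F}_q^d$ such that for every probability measure $\mu$ on $K'$ there is a non-zero $\xi\in\mathbb{F}_q^d$ with $|\widehat\mu(\xi)|\ge\kappa\,q^{-1}$.
   Context: $\mathbb{F}_q$ is the finite field with $q$ elements and $\mathbb{F}_q^d$ the $d$-dimensional vector space over it with the standard dot product. A set $K\subseteq\mathbb{F}_q^d$ is a Kakeya set if for every $x\in\mathbb{F}_q^d$ there exists $y\in\mathbb{F}_q^d$ with $\{y+ax:a\in\mathbb{F}_q\}\subseteq K$. Fix a non-trivial additive character $\chi:\mathbb{F}_q\to S^1\subseteq\mathbb{C}$; the Fourier transform of $f:\mathbb{F}_q^d\to\mathbb{C}$ is $\widehat f(\xi)=\sum_{x}\chi(-\xi\cdot x)f(x)$. A probability measure on $K$ is a non-negative function on $\mathbb{F}_q^d$ summing to $1$ with support contained in $K$. $A\gtrsim B$ means $A\ge cB$ for a constant $c>0$ independent of $q$. *)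

(* Defs.v *)
From mathcomp Require Import all_boot all_order all_algebra.
From mathcomp Require Import reals.
From mathcomp.real_closed Require Export complex.

Set Implicit Arguments.
Unset Strict Implicit.
Unset Printing Implicit Defensive.

Import Order.TTheory GRing.Theory Num.Theory.
Local Open Scope ring_scope.
Local Open Scope complex_scope.

Definition dot (F : finFieldType) (d : nat) (u v : 'rV[F]_d) : F :=
  \sum_(i < d) u 0 i * v 0 i.

(* The direction x = 0 is allowed; it only forces K to be non-empty. *)
Definition kakeya (F : finFieldType) (d : nat) (K : {set 'rV[F]_d}) : Prop :=
  forall x : 'rV[F]_d, exists y : 'rV[F]_d, forall a : F, y + a *: x \in K.

Definition additive_character (R : realType) (F : finFieldType)
    (chi : F -> R[i]) : Prop :=
  (forall a, `|chi a| = 1) /\ (forall a b, chi (a + b) = chi a * chi b).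

Definition nontrivial_character (R : realType) (F : finFieldType)
    (chi : F -> R[i]) : Prop :=
  additive_character chi /\ exists a, chi a <> 1.

Definition fourier (R : realType) (F : finFieldType) (d : nat)
    (chi : F -> R[i]) (f : 'rV[F]_d -> R[i]) (xi : 'rV[F]_d) : R[i] :=
  \sum_(x : 'rV[F]_d) chi (dot (- xi) x) * f x.

Definition probability_measure_on (R : realType) (F : finFieldType) (d : nat)
    (K : {set 'rV[F]_d}) (mu : 'rV[F]_d -> R) : Prop :=
  [/\ forall x, 0 <= mu x,
      \sum_(x : 'rV[F]_d) mu x = 1
    & forall x, mu x <> 0 -> x \in K].

Definition measure_fourier (R : realType) (F : finFieldType) (d : nat)
    (chi : F -> R[i]) (mu : 'rV[F]_d -> R) : 'rV[F]_d -> R[i] :=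
  fourier chi (fun x => (mu x)%:C).

(* Main.v *)
(** For the upper bound, choose a line in every direction [x], put the uniform
    measure on it and average over all [x]. The Fourier transform of the line
    measure at [xi] has modulus [1] if [xi . x = 0] and vanishes otherwise, so
    the average is at most the proportion [1/q] of directions orthogonal to
    [xi].

    For the size of [K], the [q] lines in the directions [(1, t, 0, ..., 0)]
    pairwise meet in at most one point, and adding them one at a time
    contributes at least [q + (q - 1) + ... + 1] points.

    For sharpness, the lines [y = t x - t^2] together with the vertical line
    [x = 0] form a planar Kakeya set with at most [(q^2 + 3 q) / 2] points, in
    every characteristic: [t |-> t x - t^2] is invariant under [t |-> x - t].
    Plancherel and Cauchy-Schwarz on the plane then force a nonzero Fourier
    coefficient of size [(1 - o(1)) / q], and taking the preimage of the planar
    set under a coordinate projection settles every dimension. *)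
Require Import Defs.
From mathcomp Require Import all_boot all_order all_algebra.
From mathcomp Require Import reals.
From mathcomp Require Import ring lra zify.

Set Implicit Arguments.
Unset Strict Implicit.
Unset Printing Implicit Defensive.

Import Order.TTheory GRing.Theory Num.Theory.
Local Open Scope ring_scope.
Local Open Scope complex_scope.

(** * Bilinearity of the dot product *)

Lemma dotDr (F : finFieldType) d (u v w : 'rV[F]_d) :
  dot u (v + w) = dot u v + dot u w.
Proof. by rewrite /dot -big_split; apply: eq_bigr => i _; rewrite mxE mulrDr. Qed.

Lemma dotDl (F : finFieldType) d (u v w : 'rV[F]_d) :
  dot (u + v) w = dot u w + dot v w.
Proof. by rewrite /dot -big_split; apply: eq_bigr => i _; rewrite mxE mulrDl. Qed.

Lemma dotZr (F : finFieldType) d a (u v : 'rV[F]_d) :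
  dot u (a *: v) = a * dot u v.
Proof. by rewrite /dot mulr_sumr; apply: eq_bigr => i _; rewrite mxE mulrCA. Qed.

Lemma dotZl (F : finFieldType) d a (u v : 'rV[F]_d) :
  dot (a *: u) v = a * dot u v.
Proof. by rewrite /dot mulr_sumr; apply: eq_bigr => i _; rewrite mxE mulrA. Qed.

Lemma dotNl (F : finFieldType) d (u v : 'rV[F]_d) : dot (- u) v = - dot u v.
Proof. by rewrite -scaleN1r dotZl mulN1r. Qed.

Lemma dotNr (F : finFieldType) d (u v : 'rV[F]_d) : dot u (- v) = - dot u v.
Proof. by rewrite -scaleN1r dotZr mulN1r. Qed.

Lemma dot0l (F : finFieldType) d (v : 'rV[F]_d) : dot 0 v = 0.
Proof. by rewrite -(scale0r 0) dotZl mul0r. Qed.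

Lemma dot0r (F : finFieldType) d (v : 'rV[F]_d) : dot v 0 = 0.
Proof. by rewrite -(scale0r 0) dotZr mul0r. Qed.

Lemma dot_surj (F : finFieldType) d (x : 'rV[F]_d) (a : F) :
  x != 0 -> exists u, dot u x = a.
Proof.
case/rV0Pn=> i xi_neq0; exists ((a / x 0 i) *: delta_mx 0 i).
rewrite dotZl /dot (bigD1 i) //= big1 => [|j /negPf ji]; last first.
  by rewrite mxE ji mul0r.
by rewrite mxE !eqxx addr0 mul1r divfK.
Qed.

Lemma dot_row_mx0 (F : finFieldType) m n (u : 'rV[F]_m) (x : 'rV[F]_(m + n)) :
  dot (row_mx u 0) x = dot u (lsubmx x).
Proof.
rewrite /dot big_split_ord /= [X in _ + X]big1 => [|i _]; last first.
  by rewrite row_mxEr mxE mul0r.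
by rewrite addr0; apply: eq_bigr => i _; rewrite row_mxEl mxE.
Qed.

(** * Orthogonality of characters and Plancherel *)

Section Characters.
Variables (R : realType) (F : finFieldType) (chi : F -> R[i]).
Hypothesis chi_nontriv : nontrivial_character chi.

Let chi_norm a : `|chi a| = 1. Proof. by case: chi_nontriv => -[]. Qed.
Let chiD a b : chi (a + b) = chi a * chi b. Proof. by case: chi_nontriv => -[]. Qed.

Let chi_neq0 a : chi a != 0.
Proof. by rewrite -normr_eq0 chi_norm oner_neq0. Qed.

Lemma character0 : chi 0 = 1.
Proof. by apply: (mulfI (chi_neq0 0)); rewrite -chiD addr0 mulr1. Qed.

Lemma characterN a : chi (- a) = (chi a)^*%C.
Proof.
apply: (mulfI (chi_neq0 a)); rewrite -chiD subrr character0.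
by rewrite -[RHS]/(chi a * Num.conj (chi a)) -normCK chi_norm expr1n.
Qed.

(** For [x != 0], translating [u] by some [v] with [chi (dot v x) <> 1] multiplies the sum by that
    value, so the sum vanishes. *)
Lemma sum_character_dot d (x : 'rV[F]_d) :
  \sum_u chi (dot u x) = if x == 0 then (#|F| ^ d)%:R else 0.
Proof.
case: eqVneq => [->|x_neq0].
  under eq_bigr do rewrite dot0r character0.
  by rewrite sumr_const card_mx mul1n.
have [a chia] := chi_nontriv.2.
have [v va] := dot_surj a x_neq0.
set S := \sum_u _.
have: chi a * S = S.
  rewrite /S [RHS](reindex_inj (addrI v)) mulr_sumr /=.
  by apply: eq_bigr => u _; rewrite dotDl chiD va.
move/eqP; rewrite -subr_eq0 -{2}[S]mul1r -mulrBl mulf_eq0 subr_eq0.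
by case/orP => /eqP.
Qed.

Lemma sum_character_mul (b : F) :
  \sum_a chi (a * b) = if b == 0 then #|F|%:R else 0.
Proof.
have -> : (b == 0) = (b%:M == 0 :> 'rV[F]_1).
  apply/eqP/eqP => [->|/rowP/(_ 0)]; first by rewrite raddf0.
  by rewrite !mxE.
rewrite -[#|F|]expn1 -sum_character_dot [RHS](reindex (fun a => a%:M)) /=.
  by apply: eq_bigr => a _; rewrite /dot big_ord1 !mxE !mulr1n.
exists (fun u : 'rV_1 => u 0 0) => u _; first by rewrite mxE.
by rewrite -mx11_scalar.
Qed.

(** The squared modulus expands into a double sum over [x] and [y], and orthogonality leaves only
    the diagonal. *)
Lemma plancherel d (f : 'rV[F]_d -> R[i]) :
  \sum_xi `|fourier chi f xi| ^+ 2 = (#|F| ^ d)%:R * \sum_x `|f x| ^+ 2.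
Proof.
transitivity (\sum_(x : 'rV[F]_d) \sum_(y : 'rV[F]_d)
    f x * Num.conj (f y) * \sum_(xi : 'rV[F]_d) chi (dot xi (y - x))).
  under eq_bigr => xi _.
    rewrite normCK /fourier rmorph_sum big_distrlr /=; over.
  rewrite exchange_big /=; apply: eq_bigr => x _.
  rewrite exchange_big /=; apply: eq_bigr => y _.
  rewrite mulr_sumr; apply: eq_bigr => xi _.
  rewrite rmorphM /= -[Num.conj (chi _)]/((chi _)^*%C) -characterN.
  rewrite !dotNl opprK dotDr dotNr addrC chiD; ring.
rewrite mulr_sumr; apply: eq_bigr => x _.
rewrite (bigD1 x) //= [X in _ + X]big1 => [|y yx]; rewrite sum_character_dot subr_eq0.
  by rewrite eqxx normCK addr0 mulrC.
by rewrite (negPf yx) mulr0.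
Qed.

End Characters.

(** * Small support forces a large Fourier coefficient *)

(** Cauchy-Schwarz against a constant, read off from the non-negative sum of
    [(n * f x - S) ^+ 2]. *)
Lemma sqr_sum_le_card (R : realType) (T : finType) (A : {set T}) (f : T -> R) :
  (\sum_(x in A) f x) ^+ 2 <= #|A|%:R * \sum_(x in A) f x ^+ 2.
Proof.
have [->|A0] := eqVneq A set0; first by rewrite !big_set0 expr0n mulr0.
have n_gt0 : 0 < #|A|%:R :> R by rewrite ltr0n card_gt0.
set n := #|A|%:R : R; set S := \sum_(x in A) f x; set Q := \sum_(x in A) _.
have: 0 <= \sum_(x in A) (n * f x - S) ^+ 2 by apply: sumr_ge0 => x _; exact: sqr_ge0.
have -> : \sum_(x in A) (n * f x - S) ^+ 2 = n * (n * Q - S ^+ 2).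
  under eq_bigr do rewrite sqrrB exprMn.
  rewrite big_split sumrB /= sumr_const -[_ *+ #|A|]mulr_natl -/n -mulr_sumr -/Q.
  under [X in _ - X + _]eq_bigr do rewrite mulrAC.
  rewrite sumrMnl -mulr_sumr -/S; ring.
by rewrite pmulr_rge0 // subr_ge0.
Qed.

Lemma measure_fourier0 (R : realType) (F : finFieldType) d (chi : F -> R[i])
    (K : {set 'rV[F]_d}) (mu : 'rV[F]_d -> R) :
  nontrivial_character chi -> probability_measure_on K mu ->
  measure_fourier chi mu 0 = 1.
Proof.
move=> hchi [_ mu1 _]; rewrite /measure_fourier /fourier.
under eq_bigr do rewrite oppr0 dot0l (character0 hchi) mul1r.
by rewrite -rmorph_sum mu1.
Qed.

(** Cauchy-Schwarz bounds the sum of [mu x ^+ 2] below by [1 / #|K|]. Plancherel bounds it above: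
    frequency [0] contributes [1], every other one at most [M ^+ 2]. *)
Lemma support_card_ge (R : realType) (F : finFieldType) d (chi : F -> R[i])
    (K : {set 'rV[F]_d}) (mu : 'rV[F]_d -> R) (M : R) :
  nontrivial_character chi -> probability_measure_on K mu ->
  (forall xi, xi != 0 -> `|measure_fourier chi mu xi| <= M%:C) ->
  (#|F| ^ d)%:R <= #|K|%:R * (1 + (#|F| ^ d)%:R * M ^+ 2) :> R.
Proof.
move=> hchi hmu hM; have [mu_ge0 mu1 muK] := hmu.
set N : R := (_ ^ _)%:R.
have muK0 x : x \notin K -> mu x = 0.
  by move=> xK; apply/eqP; apply: contraNT xK => /eqP; exact: muK.
have CS : 1 <= #|K|%:R * \sum_x mu x ^+ 2.
  have muK1 : \sum_(x in K) mu x = 1.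
    by rewrite -mu1 [RHS](bigID (mem K)) /= [X in _ + X]big1 ?addr0.
  rewrite -[leLHS](expr1n _ 2) -[X in X ^+ 2]muK1.
  apply: le_trans (sqr_sum_le_card _ _) _; rewrite ler_wpM2l ?ler0n //.
  by rewrite [leRHS](bigID (mem K)) /= lerDl sumr_ge0 // => x _; exact: sqr_ge0.
have PL : N * \sum_x mu x ^+ 2 <= 1 + N * M ^+ 2.
  rewrite -lecR rmorphM rmorph_sum rmorphD rmorphM /= rmorph1 rmorphXn /= rmorph_nat.
  under eq_bigr => x _ do
    rewrite rmorphXn /= -[(mu x)%:C]ger0_norm ?ler0c //.
  rewrite -(plancherel hchi) (bigD1 0) //= -/(measure_fourier chi mu 0).
  rewrite (measure_fourier0 hchi hmu).
  rewrite normr1 expr1n lerD2l.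
  apply: (@le_trans _ _ (\sum_(xi : 'rV[F]_d | xi != 0) M%:C ^+ 2)).
    apply: ler_sum => xi xi0.
    by rewrite lerXn2r ?nnegrE ?normr_ge0 ?hM // (le_trans _ (hM _ xi0)).
  (* The number of nonzero frequencies is relaxed to [#|F| ^ d]. *)
  rewrite sumr_const -[_ *+ _]mulr_natl -!rmorphXn /=.
  rewrite -!(rmorph_nat (real_complex R)) -!rmorphM /= lecR.
  rewrite ler_wpM2r ?sqr_ge0 // ler_nat.
  by apply: leq_trans (max_card _) _; rewrite card_mx mul1n.
apply: (@le_trans _ _ (N * (#|K|%:R * \sum_x mu x ^+ 2))).
  by rewrite ler_peMr ?ler0n.
by rewrite mulrCA ler_wpM2l ?ler0n.
Qed.

(** * A measure with Fourier decay on every Kakeya set *)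

Lemma kakeya_fourier_decay (R : realType) (F : finFieldType) d
    (chi : F -> R[i]) (K : {set 'rV[F]_d}) :
  nontrivial_character chi -> kakeya K ->
  exists mu : 'rV[F]_d -> R,
    probability_measure_on K mu /\
    forall xi, xi <> 0 -> `|measure_fourier chi mu xi| <= (#|F|%:R)^-1.
Proof.
move=> hchi /fin_all_exists [y yK].
have q_neq0 (S : numDomainType) : #|F|%:R != 0 :> S.
  by rewrite pnatr_eq0 -lt0n; apply/card_gt0P; exists 0.
have chiD := hchi.1.2; have chi1 := hchi.1.1.
(* Normalisation: [#|F| ^ d] directions, each with [#|F|] parameters on its line. Direction [0]
   counts its single point [#|F|] times. *)
pose c : R := ((#|F| ^ d)%:R * #|F|%:R)^-1.
have c_ge0 : 0 <= c by rewrite invr_ge0 mulr_ge0 ?ler0n.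
pose mu z : R := c * \sum_x \sum_(a : F) (z == y x + a *: x)%:R.
(* Stated over an arbitrary ring, as it serves both the total mass in [R] and the Fourier transform
   in [R[i]]. *)
have sum_mu (S : comPzRingType) (g : 'rV[F]_d -> S) :
    \sum_z g z * (\sum_x \sum_(a : F) (z == y x + a *: x)%:R)
      = \sum_x \sum_a g (y x + a *: x).
  under eq_bigr do rewrite mulr_sumr.
  rewrite exchange_big; apply: eq_bigr => x _ /=.
  under eq_bigr do rewrite mulr_sumr.
  rewrite exchange_big; apply: eq_bigr => a _ /=.
  rewrite (bigD1 (y x + a *: x)) //= eqxx mulr1 big1 ?addr0 // => z /negPf ->.
  by rewrite mulr0.
exists mu; split; first split.
- by move=> z; rewrite mulr_ge0 // sumr_ge0 // => x _; rewrite sumr_ge0.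
- rewrite -mulr_sumr -(eq_bigr _ (fun z _ => mul1r _)).
  rewrite (sum_mu _ (fun=> 1)) !sumr_const card_mx mul1n -mulrnA.
  rewrite /c mulnC natrM mulVf //.
  by rewrite mulf_neq0 ?natrX ?expf_neq0 ?q_neq0.
- move=> z muz; apply: contra_notT muz => zK.
  rewrite /mu big1 ?mulr0 // => x _; rewrite big1 // => a _.
  by case: eqP zK => // ->; rewrite yK.
move=> xi /eqP xi0.
have -> : measure_fourier chi mu xi = c%:C *
    \sum_x chi (dot (- xi) (y x)) * \sum_a chi (a * dot (- xi) x).
  rewrite /measure_fourier /fourier.
  under eq_bigr => z _.
    rewrite rmorphM /= mulrCA rmorph_sum.
    under eq_bigr => x _.
      rewrite rmorph_sum; under eq_bigr do rewrite rmorph_nat; over.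
    over.
  rewrite -mulr_sumr (sum_mu _ (fun z => chi (dot (- xi) z))); congr (_ * _).
  apply: eq_bigr => x _; rewrite mulr_sumr; apply: eq_bigr => a _.
  by rewrite dotDr chiD dotZr.
rewrite normrM [X in X * _]ger0_norm ?ler0c //.
(* Each inner sum is [#|F|] or [0], hence equal to its modulus. After exchanging the sums only
   [a = 0] contributes, since otherwise [a *: - xi] is a nonzero frequency. *)
have bound : `|\sum_x chi (dot (- xi) (y x)) * \sum_a chi (a * dot (- xi) x)|
    <= (#|F| ^ d)%:R.
  apply: le_trans (ler_norm_sum _ _ _) _.
  rewrite le_eqVlt; apply/orP; left; apply/eqP.
  transitivity (\sum_x \sum_a chi (dot (a *: - xi) x)).
    apply: eq_bigr => x _; rewrite normrM chi1 mul1r.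
    under [RHS]eq_bigr do rewrite dotZl.
    by rewrite (sum_character_mul hchi) ger0_norm //; case: ifP.
  rewrite exchange_big (bigD1 0) //= [X in _ + X]big1 ?addr0 => [|a a0].
    under eq_bigr do rewrite scale0r dot0l (character0 hchi).
    by rewrite sumr_const card_mx mul1n.
  transitivity (\sum_x chi (dot x (a *: - xi))).
    by apply: eq_bigr => x _; congr chi; apply: eq_bigr => i _; rewrite mulrC.
  by rewrite (sum_character_dot hchi) scaler_eq0 oppr_eq0 (negPf a0) (negPf xi0).
apply: le_trans (ler_wpM2l _ bound) _; first by rewrite ler0c.
rewrite /c fmorphV rmorphM /= !rmorph_nat invfM mulrAC mulVf ?mul1r //.
by rewrite natrX expf_neq0 ?q_neq0.
Qed.

(** * Size of a Kakeya set *)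

(** A new set meets the union of [k] earlier ones in at most [k] points. Doubling and the additive
    form avoid division and truncated subtraction; [size s * size s] slightly relaxes the exact
    [size s * (size s - 1)]. *)
Lemma card_bigcup_ge (I T : finType) (L : I -> {set T}) (n : nat) (s : seq I) :
  uniq s -> (forall i, #|L i| = n) ->
  (forall i j, i != j -> #|L i :&: L j| <= 1)%N ->
  (2 * n * size s <= 2 * #|\bigcup_(i <- s) L i| + size s * size s)%N.
Proof.
move=> + Ln LI; elim: s => [|i s IHs] /=; first by rewrite !muln0.
case/andP=> i_s /IHs {}IHs; rewrite big_cons.
set U := \bigcup_(j <- s) L j in IHs *.
have LU : (#|L i :&: U| <= size s)%N.
  rewrite /U; elim: s i_s {IHs U} => [|j s IHs] /=.
    by rewrite big_nil setI0 cards0.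
  rewrite inE negb_or => /andP[ij /IHs {}IHs]; rewrite big_cons setIUr.
  apply: leq_trans (leq_card_setU _ _) _; rewrite -add1n.
  by rewrite leq_add ?LI.
have := cardsUI (L i) U; rewrite Ln => cU; nia.
Qed.

Lemma kakeya_card_ge (F : finFieldType) n (K : {set 'rV[F]_(2 + n)}) :
  kakeya K -> (#|F| ^ 2 <= 2 * #|K|)%N.
Proof.
case/fin_all_exists=> y yK.
pose dir (t : F) : 'rV[F]_(2 + n) :=
  row_mx (\row_(j < 2) if j == 0 then 1 else t) 0.
have dir0 t : dir t 0 (lshift n 0) = 1 by rewrite row_mxEl mxE.
have dir1 t : dir t 0 (lshift n 1) = t by rewrite row_mxEl mxE.
pose pt t a := y (dir t) + a *: dir t.
pose L t := [set pt t a | a : F].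
have pt_inj t : injective (pt t).
  move=> a b /addrI/rowP/(_ (lshift n 0)).
  by rewrite [LHS]mxE [RHS]mxE dir0 !mulr1.
have cardL t : #|L t| = #|F| by rewrite card_imset.
have LI t u : t != u -> (#|L t :&: L u| <= 1)%N.
  move=> tu; apply/card_le1_eqP => v w.
  rewrite !inE => /andP[/imsetP[a _ ->] /imsetP[b _ eab]].
  move=> /andP[/imsetP[a' _ ->] /imsetP[b' _ eab']].
  (* The difference of two common points is a multiple of both directions. Coordinate [0] makes the
     two multiples equal, and coordinate [1] then makes them zero because [t != u]. *)
  have E : (a - a') *: dir t = (b - b') *: dir u.
    rewrite !scalerBl; have -> : a *: dir t - a' *: dir t = pt t a - pt t a'.
      by rewrite /pt opprD addrACA subrr add0r.
    by rewrite eab eab' /pt opprD addrACA subrr add0r.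
  move: (congr1 (fun v : 'rV_(2 + n) => v 0 (lshift n 0)) E).
  rewrite [LHS]mxE [RHS]mxE !dir0 !mulr1 => eb.
  move: (congr1 (fun v : 'rV_(2 + n) => v 0 (lshift n 1)) E).
  rewrite [LHS]mxE [RHS]mxE !dir1 -eb => /eqP.
  rewrite -subr_eq0 -mulrBr mulf_eq0 !subr_eq0 (negPf tu) orbF.
  by move=> /eqP->.
have := card_bigcup_ge (enum_uniq F) cardL LI.
(* Set size and number of lines are both [#|F|], so one [#|F| ^ 2] cancels. *)
rewrite -cardE -mulnA mulnn mulSn mul1n leq_add2r => /leq_trans; apply.
rewrite leq_pmul2l // bigcup_seq.
apply/subset_leq_card/bigcupsP => t _.
by apply/subsetP => _ /imsetP[a _ ->]; exact: yK.
Qed.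

(** * A small planar Kakeya set *)

(** A fibre of [f] contains [s t] along with [t], so it has two elements or contributes a fixed
    point of [s]. *)
Lemma leq_card_imset_invariant (T U : finType) (f : T -> U) (s : T -> T) :
  (forall t, f (s t) = f t) ->
  (2 * #|f @: T| <= #|T| + #|[set t | s t == t]|)%N.
Proof.
move=> fs.
rewrite -sum1_card -[X in (_ <= X + _)%N]sum1_card.
rewrite -[X in (_ <= _ + X)%N]sum1_card [X in (_ <= _ + X)%N]big_mkcond -big_split /=.
rewrite (partition_big_imset f) /= big_distrr /=; apply: leq_sum => u /imsetP[t _ ->].
rewrite muln1 (bigD1 t) //= inE; case: (eqVneq (s t) t) => [_|st]; first by [].
by rewrite (bigD1 (s t)) /= ?fs ?eqxx ?st.
Qed.

(** In odd characteristic the lines [y = t x - t^2] are the tangents of the parabola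
    [y = x^2 / 4]. *)
Definition parabola_kakeya (F : finFieldType) : {set 'rV[F]_2} :=
  [set v : 'rV[F]_2 | (v 0 0 == 0) || [exists t, v 0 1 == t * v 0 0 - t ^+ 2]].

Lemma parabola_kakeyaP (F : finFieldType) : kakeya (parabola_kakeya F).
Proof.
move=> x; have [x0|x0] := eqVneq (x 0 0) 0.
  by exists 0 => a; rewrite inE add0r mxE x0 mulr0 eqxx.
(* The slope of [x]; the line of that slope meets the vertical axis at [(0, - t ^+ 2)]. *)
pose t := x 0 1 / x 0 0.
exists (\row_j if j == 0 then 0 else - t ^+ 2) => a.
rewrite inE; apply/orP; right; apply/existsP; exists t; rewrite !mxE /=.
by apply/eqP; rewrite /t; field.
Qed.

Lemma card_parabola_kakeya (F : finFieldType) :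
  (2 * #|parabola_kakeya F| <= #|F| ^ 2 + 3 * #|F|)%N.
Proof.
pose mk (x y : F) : 'rV[F]_2 := \row_j if j == 0 then x else y.
have mkE (v : 'rV[F]_2) : v = mk (v 0 0) (v 0 1).
  apply/rowP => j; rewrite mxE.
  by case: j => -[|[|//]] h /=; congr (v 0 _); exact: val_inj.
pose f (p : F * F) := mk p.1 (p.2 * p.1 - p.2 ^+ 2).
pose s (p : F * F) := (p.1, p.1 - p.2).
have fs p : f (s p) = f p by rewrite /f /s /=; congr mk; ring.
have sub : parabola_kakeya F \subset (mk 0 @: F) :|: (f @: {: F * F}).
  apply/subsetP => v; rewrite !inE => /orP[/eqP v0|/existsP[t /eqP vt]].
    by apply/orP; left; apply/imsetP; exists (v 0 1); rewrite // -v0 -mkE.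
  apply/orP; right; apply/imsetP; exists (v 0 0, t) => //.
  by rewrite /f /= -vt -mkE.
(* A fixed point has [x = t + t], so [t] determines it in every characteristic. *)
have fixs : (#|[set p | s p == p]| <= #|F|)%N.
  apply: (@leq_trans #|[set (t + t, t) | t : F]|); last exact: leq_imset_card.
  apply/subset_leq_card/subsetP => -[x t]; rewrite inE => /eqP[/eqP].
  rewrite subr_eq => /eqP ->; exact: imset_f.
have cB := leq_card_imset_invariant fs; rewrite card_prod in cB.
have cU := leq_trans (subset_leq_card sub) (leq_card_setU _ _).
have arith k a b p q : (k <= a + b -> a <= q -> 2 * b <= q * q + p ->
    p <= q -> 2 * k <= q * q + 3 * q)%N by lia.
exact: arith cU (leq_imset_card _ _) cB fixs.
Qed.

Lemma parabola_kakeya_fourier (R : realType) (kappa : R) :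
  0 < kappa -> kappa < 1 ->
  exists q0 : nat, forall (F : finFieldType) (chi : F -> R[i]),
    nontrivial_character chi -> (q0 <= #|F|)%N ->
    forall mu : 'rV[F]_2 -> R, probability_measure_on (parabola_kakeya F) mu ->
    exists xi, xi <> 0 /\
      kappa%:C * (#|F|%:R)^-1 <= `|measure_fourier chi mu xi|.
Proof.
(* The argument ends with [2 q <= (q + 3) (1 + kappa^2)], that is
   [q (1 - kappa^2) <= 3 (1 + kappa^2) < 6], which [q > B] contradicts. *)
move=> k0 k1; pose B := 6 / (1 - kappa ^+ 2).
have k2 : kappa ^+ 2 < 1 by rewrite expr_lt1 // ltW.
have B_ge0 : 0 <= B by rewrite divr_ge0 // subr_ge0 ltW.
exists (Num.bound B) => F chi hchi hq mu hmu.
have qB : B < #|F|%:R.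
  by apply: lt_le_trans (archi_boundP B_ge0) _; rewrite ler_nat.
have q_gt0 : 0 < #|F|%:R :> R by apply: le_lt_trans qB.
have [/existsP[xi /andP[/eqP xi0 ?]]|] :=
    boolP [exists xi : 'rV[F]_2, (xi != 0) &&
       (kappa%:C * (#|F|%:R)^-1 <= `|measure_fourier chi mu xi|)].
  by exists xi.
rewrite negb_exists => /forallP small.
have MC : (kappa / #|F|%:R)%:C = kappa%:C * (#|F|%:R)^-1.
  by rewrite rmorphM fmorphV rmorph_nat.
have hM xi : xi != 0 -> `|measure_fourier chi mu xi| <= (kappa / #|F|%:R)%:C.
  move=> xi0; move: (small xi); rewrite xi0 /= -MC.
  rewrite -real_ltNge ?normr_real //; first exact: ltW.
  by rewrite ger0_real // ler0c divr_ge0 // ltW.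
(* With [M = kappa / q] in dimension [2], the factor [1 + q^2 M^2] is [1 + kappa^2]. *)
have := support_card_ge hchi hmu hM.
have := card_parabola_kakeya F.
rewrite -(ler_nat R) natrM natrD natrX natrM => cK.
set q : R := #|F|%:R in cK qB q_gt0 *; set K : R := #|_|%:R in cK *.
rewrite expr_div_n mulrCA divff ?expf_neq0 ?gt_eqF // mulr1 => qK.
move: qB; rewrite ltr_pdivrMr ?subr_gt0 // => qB.
have : 2 * q ^+ 2 <= (q ^+ 2 + 3 * q) * (1 + kappa ^+ 2).
  apply: le_trans (_ : 2 * (K * (1 + kappa ^+ 2)) <= _); first by rewrite ler_pM2l.
  by rewrite mulrA ler_wpM2r // addr_ge0 // sqr_ge0.
have -> : 2 * q ^+ 2 = q * (2 * q) by ring.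
have -> : (q ^+ 2 + 3 * q) * (1 + kappa ^+ 2) = q * ((q + 3) * (1 + kappa ^+ 2)).
  by ring.
rewrite ler_pM2l // => ?; exfalso; lra.
Qed.

(** * Passage from the plane to higher dimension *)

Lemma kakeya_lsubmx_preimage (F : finFieldType) m n (K : {set 'rV[F]_m}) :
  kakeya K -> kakeya [set v : 'rV[F]_(m + n) | lsubmx v \in K].
Proof.
move=> hK x; have [y yK] := hK (lsubmx x); exists (row_mx y 0) => a.
by rewrite inE linearD linearZ /= row_mxKl.
Qed.

Definition pushforward (R : realType) (F : finFieldType) m n
    (mu : 'rV[F]_(m + n) -> R) (u : 'rV[F]_m) : R :=
  \sum_(x | lsubmx x == u) mu x.

Lemma pushforward_probability (R : realType) (F : finFieldType) m n
    (K : {set 'rV[F]_m}) (mu : 'rV[F]_(m + n) -> R) :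
  probability_measure_on [set v | lsubmx v \in K] mu ->
  probability_measure_on K (pushforward mu).
Proof.
move=> [mu_ge0 mu1 muK]; split.
- by move=> u; apply: sumr_ge0.
- by rewrite -mu1 [RHS](partition_big (fun x => lsubmx x) xpredT).
move=> u; apply: contra_notT => uK; rewrite /pushforward big1 // => x /eqP xu.
by apply/eqP; apply: contraNT uK => /eqP/muK; rewrite inE xu.
Qed.

(** The character at frequency [row_mx xi 0] is constant on the fibres of [lsubmx], so planar
    coefficients are coefficients of the original measure. *)
Lemma fourier_pushforward (R : realType) (F : finFieldType) m n
    (chi : F -> R[i]) (mu : 'rV[F]_(m + n) -> R) (xi : 'rV[F]_m) :
  measure_fourier chi (pushforward mu) xi = measure_fourier chi mu (row_mx xi 0).
Proof.
rewrite /measure_fourier /fourier.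
rewrite [RHS](partition_big (fun x => lsubmx x) xpredT) //=.
apply: eq_bigr => u _; rewrite rmorph_sum mulr_sumr.
by apply: eq_bigr => x /eqP <-; rewrite !dotNl dot_row_mx0.
Qed.

Theorem theorem2p4 (R : realType) (d : nat) (hd : (2 <= d)%N) :
  (forall (F : finFieldType) (chi : F -> R[i]) (K : {set 'rV[F]_d}),
     nontrivial_character chi -> kakeya K ->
     exists mu : 'rV[F]_d -> R,
       probability_measure_on K mu /\
       forall xi : 'rV[F]_d, xi <> 0 ->
         `|measure_fourier chi mu xi| <= (#|F|%:R)^-1)
  /\
  (exists2 c : R, 0 < c &
     forall (F : finFieldType) (K : {set 'rV[F]_d}),
       kakeya K -> c * #|F|%:R ^+ 2 <= #|K|%:R)
  /\
  (forall kappa : R, 0 < kappa -> kappa < 1 ->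
     exists q0 : nat,
       forall (F : finFieldType) (chi : F -> R[i]),
         nontrivial_character chi -> (q0 <= #|F|)%N ->
         exists K' : {set 'rV[F]_d},
           kakeya K' /\
           forall mu : 'rV[F]_d -> R, probability_measure_on K' mu ->
             exists xi : 'rV[F]_d, xi <> 0 /\
               kappa%:C * (#|F|%:R)^-1 <= `|measure_fourier chi mu xi|).
Proof.
(* This form of the dimension makes the projection [lsubmx] to the plane available. *)
have [n -> {d hd}] : exists n, d = (2 + n)%N by exists (d - 2)%N; rewrite subnKC.
split; first by move=> F chi K; exact: kakeya_fourier_decay.
split.
  exists 2^-1; first by rewrite invr_gt0.
  move=> F K /kakeya_card_ge; rewrite -(ler_nat R) natrX natrM => hK.
  by rewrite mulrC ler_pdivrMr // mulrC.
move=> kappa k0 k1; have [q0 hq0] := parabola_kakeya_fourier k0 k1.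
exists q0 => F chi hchi hq.
exists [set v | lsubmx v \in parabola_kakeya F]; split.
  exact/kakeya_lsubmx_preimage/parabola_kakeyaP.
move=> mu /pushforward_probability /(hq0 F chi hchi hq) [xi [xi0 hxi]].
exists (row_mx xi 0); split; last by rewrite -fourier_pushforward.
by apply: contra_not xi0 => /(congr1 lsubmx); rewrite row_mxKl linear0.
Qed.
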